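(* (i) Let $r\in\mathbb Z_+$ be even and $\Gamma=\Gamma_{(r,r)}$. For every $E\in(-4,4)\setminus\{0\}$ there exists $1\le j\le r^2$ with $E\in\operatorname{int}B_j^\Gamma$. (ii) If $\mathfrak p=(p,q)$ with $p$ odd and $q$ divisible by four, then $0\in\operatorname{int}B_j^{\Gamma_{\mathfrak p}}$ for some $1\le j\le pq$.
   Context: For $r\ge3$ and $\theta\in\mathbb R$, $\Delta_\theta^r\in\mathbb C^{r\times r}$ is the Hermitian matrix with $1$ on the sub- and superdiagonals, $0$ on the diagonal, entry $e^{-i\theta}$ in position $(1,r)$ and $e^{i\theta}$ in position $(r,1)$, all other entries $0$; $\Delta_\theta^1=2\cos\theta$, $\Delta_\theta^2=\begin{bmatrix}0&1+e^{-i\theta}\\1+e^{i\theta}&0\end{bmatrix}$. For $\mathfrak p=(p,q)$, $\Gamma_{\mathfrak p}=([0,p)\times[0,q))\cap\mathbb Z^2$ and $\Delta^{\Gamma_{\mathfrak p}}_{\theta,\varphi}=\Delta_\theta^p\otimes I_q+I_p\otimes\Delta_\varphi^q$ (the discrete Laplacian on $\mathbb Z^2$ restricted to Floquet–Bloch functions with $\psi_{n+p,m}=e^{i\theta}\psi_{n,m}$, $\psi_{n,m+q}=e^{i\varphi}\psi_{n,m}$). Its eigenvalues counted with multiplicity are $\lambda_1^\Gamma(\theta,\varphi)\le\cdots\le\lambda_{pq}^\Gamma(\theta,\varphi)$, and the $j$th band is $B_j^\Gamma=\{\lambda_j^\Gamma(\theta,\varphi):(\theta,\varphi)\in[0,\pi]^2\}$.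 $\operatorname{int}$ denotes interior in $\mathbb R$. *)

(* Defs.v *)
From Stdlib Require Import Reals Lra List Sorting.Sorted Arith.
Open Scope R_scope.

Definition C : Type := (R * R)%type.
Definition C0 : C := (0, 0).
Definition C1 : C := (1, 0).
Definition RtoC (x : R) : C := (x, 0).
Definition Cadd (z w : C) : C := (fst z + fst w, snd z + snd w).
Definition Cmul (z w : C) : C :=
  (fst z * fst w - snd z * snd w, fst z * snd w + snd z * fst w).
Definition Copp (z : C) : C := (- fst z, - snd z).
Definition Csub (z w : C) : C := Cadd z (Copp w).
Definition Cexpi (t : R) : C := (cos t, sin t).

(* ---------- Square matrices indexed by nat (entries outside n x n ignored) ---------- *)
Definition Mat : Type := nat -> nat -> C.

Definition Csum (n : nat) (f : nat -> C) : C :=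
  fold_right Cadd C0 (map f (seq 0 n)).

Definition minor0 (j : nat) (M : Mat) : Mat :=
  fun i k => M (S i) (if Nat.ltb k j then k else S k).

Fixpoint det (n : nat) (M : Mat) : C :=
  match n with
  | O => C1
  | S n' => Csum n (fun j =>
      Cmul (if Nat.even j then C1 else Copp C1) (Cmul (M 0%nat j) (det n' (minor0 j M))))
  end.

Definition ind (b : bool) : C := if b then C1 else C0.

Definition Delta (r : nat) (theta : R) : Mat :=
  fun i k =>
    match r with
    | O => C0
    | 1%nat => RtoC (2 * cos theta)
    | 2%nat =>
        if (Nat.eqb i 0 && Nat.eqb k 1)%bool then Cadd C1 (Cexpi (- theta))
        else if (Nat.eqb i 1 && Nat.eqb k 0)%bool then Cadd C1 (Cexpi theta)
        else C0
    | _ =>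
        if (Nat.eqb i 0 && Nat.eqb k (r - 1))%bool then Cexpi (- theta)
        else if (Nat.eqb i (r - 1) && Nat.eqb k 0)%bool then Cexpi theta
        else if (Nat.eqb k (S i) || Nat.eqb i (S k))%bool then C1
        else C0
    end.

(* Delta_theta^p (x) I_q + I_p (x) Delta_phi^q, with the standard Kronecker
   indexing: (n, m) in [0,p) x [0,q)  <->  n * q + m. *)
Definition LapGamma (p q : nat) (theta phi : R) : Mat :=
  fun i k =>
    Cadd (Cmul (Delta p theta (i / q)%nat (k / q)%nat) (ind (Nat.eqb (i mod q)%nat (k mod q)%nat)))
         (Cmul (ind (Nat.eqb (i / q)%nat (k / q)%nat)) (Delta q phi (i mod q)%nat (k mod q)%nat)).

Definition shiftMat (x : R) (M : Mat) : Mat :=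
  fun i k => Csub (Cmul (RtoC x) (ind (Nat.eqb i k))) (M i k).

(* l is the nondecreasing list of the eigenvalues (counted with multiplicity)
   of the n x n matrix M: the characteristic polynomial det(x I - M) equals
   prod_i (x - l_i).  For Hermitian M such a real list exists and is unique. *)
Definition sorted_eigenvalues (n : nat) (M : Mat) (l : list R) : Prop :=
  (length l = n)%nat /\ Sorted Rle l /\
  forall x : R, det n (shiftMat x M) = fold_right Cmul C1 (map (fun lam => RtoC (x - lam)) l).

(* lambda_j^Gamma(theta,phi) = E  (j is 1-based, 1 <= j <= pq) *)
Definition lambdaGamma (p q j : nat) (theta phi E : R) : Prop :=
  exists l, sorted_eigenvalues (p * q) (LapGamma p q theta phi) l /\ nth (j - 1) l 0 = E.

Definition band (p q j : nat) (E : R) : Prop :=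
  exists theta phi, 0 <= theta <= PI /\ 0 <= phi <= PI /\ lambdaGamma p q j theta phi E.

Definition int_R (S : R -> Prop) (x : R) : Prop :=
  exists eps, 0 < eps /\ forall y, Rabs (y - x) < eps -> S y.

(* Main.v *)
Require Import Defs.
From Stdlib Require Import Reals Arith Lra Lia List Permutation Sorting.Sorted.
From mathcomp Require all_boot all_algebra Rstruct complex.
Open Scope R_scope.

(* Since Delta_theta^r is diagonalised by Bloch vectors, the eigenvalues at (theta, phi) are
   2 cos x + 2 cos y with x in (theta + 2 PI Z) / p and y in (phi + 2 PI Z) / q. If more
   eigenvalues lie below E at one pair of angles than lie at or below E at another pair, the
   intermediate value theorem puts E in the interior of a band. To get such pairs, take a base
   pair at which E is an eigenvalue, and move along two lines through it. An eigenvalue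
   crossing E transversally is below E at exactly one of the two ends of a short segment, so
   comparing the counts summed over both ends of each segment leaves only the tangential
   crossings, and those are arranged to push the two sums apart. *)

(** * The characteristic polynomial *)

(** Angles are neither reduced modulo a period nor confined to [0, PI], so every branch of [eig] is
    smooth along straight lines in (theta, phi). *)
Definition angle (r : nat) (theta : R) (k : nat) : R := (theta + 2 * PI * INR k) / INR r.

Definition eig (p q : nat) (theta phi : R) (i : nat) : R :=
  2 * cos (angle p theta (i / q)) + 2 * cos (angle q phi (i mod q)).

Lemma cos_lt_1 u : 0 < u < 2 * PI -> cos u < 1.
Proof.
  intros Hu. replace u with (2 * (u / 2)) by field. rewrite cos_2a_sin.
  assert (0 < sin (u / 2)) by (apply sin_gt_0; lra). nra.
Qed.

Lemma Cexpi_add a b : Cexpi (a + b) = Cmul (Cexpi a) (Cexpi b).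
Proof. unfold Cexpi, Cmul; simpl. rewrite cos_plus, sin_plus. f_equal; ring. Qed.

Lemma Cexpi_0 : Cexpi 0 = Defs.C1.
Proof. unfold Cexpi, Defs.C1. now rewrite cos_0, sin_0. Qed.

Lemma Cexpi_INR_S n x : Cexpi (INR (S n) * x) = Cmul (Cexpi x) (Cexpi (INR n * x)).
Proof. rewrite S_INR, <- Cexpi_add. f_equal. ring. Qed.

Lemma Cexpi_2cos x : RtoC (2 * cos x) = Cadd (Cexpi x) (Cexpi (- x)).
Proof. unfold RtoC, Cadd, Cexpi; simpl. rewrite cos_neg, sin_neg. f_equal; ring. Qed.

(* If theta' = - theta up to a period, the phases are the negated angles. *)
Lemma Bloch_phases r theta theta' : (0 < r)%nat -> cos theta' = cos theta ->
  exists u : nat -> R,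
    (forall k, Cexpi (INR r * u k) = Cexpi theta') /\
    (forall k, cos (u k) = cos (angle r theta k)) /\
    (forall k k', (k < r)%nat -> (k' < r)%nat -> k <> k' ->
       Cexpi (u k' - u k) <> Defs.C1).
Proof.
  intros Hr Hcos. assert (Hr' := lt_0_INR _ Hr).
  assert (Hs : exists s, (s = 1 \/ s = -1) /\ sin theta' = s * sin theta).
  { assert (H1 := sin2_cos2 theta). assert (H2 := sin2_cos2 theta'). unfold Rsqr in *.
    rewrite Hcos in H2.
    assert (H : (sin theta' - sin theta) * (sin theta' + sin theta) = 0) by nra.
    apply Rmult_integral in H. destruct H as [H|H]; [exists 1|exists (-1)]; split; auto; lra. }
  destruct Hs as [s [Hs Hsin]]. exists (fun k => s * angle r theta k).
  split; [|split].
  - intros k. unfold Cexpi.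
    replace (INR r * (s * angle r theta k)) with (s * (theta + 2 * INR k * PI))
      by (unfold angle; field; lra).
    rewrite Hcos, Hsin. destruct Hs as [-> | ->].
    + rewrite !Rmult_1_l, cos_period, sin_period. reflexivity.
    + replace (-1 * (theta + 2 * INR k * PI)) with (- (theta + 2 * INR k * PI)) by ring.
      rewrite cos_neg, sin_neg, cos_period, sin_period. f_equal. ring.
  - intros k. destruct Hs as [-> | ->]; [now rewrite Rmult_1_l|].
    rewrite <- cos_neg. f_equal. ring.
  (* Two distinct angles differ by a nonzero amount smaller than a full period, so the cosine of
     their difference stays below 1. *)
  - assert (Hlt : forall k k', (k < k' < r)%nat -> cos (2 * PI * (INR k' - INR k) / INR r) <> 1).
    { intros k k' [H1 H2]. apply lt_INR in H1, H2. assert (H0 := pos_INR k).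
      apply Rlt_not_eq, cos_lt_1. assert (H := PI_RGT_0).
      replace (2 * PI * (INR k' - INR k) / INR r) with (2 * PI * ((INR k' - INR k) / INR r))
        by (field; lra).
      assert (0 < (INR k' - INR k) / INR r < 1).
      { split; [apply Rdiv_lt_0_compat; lra|].
        apply (Rmult_lt_reg_r (INR r)); [exact Hr'|]. field_simplify; lra. }
      nra. }
    intros k k' Hk Hk' Hne Hc. injection Hc as Hc _.
    assert (Hc' : cos (2 * PI * (INR k' - INR k) / INR r) = 1).
    { rewrite <- Hc. destruct Hs as [-> | ->].
      - f_equal. unfold angle. field. lra.
      - rewrite <- cos_neg. f_equal. unfold angle. field. lra. }
    destruct (Nat.lt_total k k') as [H|[H|H]]; [|contradiction|].
    + exact (Hlt k k' (conj H Hk') Hc').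
    + apply (Hlt k' k (conj H Hk)). rewrite <- Hc', <- cos_neg. f_equal. field. lra.
Qed.

(** * Diagonalisation by Bloch vectors *)

Module CharPoly.
Import all_boot all_algebra Rstruct complex.
Import GRing.Theory.
Local Open Scope ring_scope.
Local Notation RC := (complex Rdefinitions.R).

Definition toC (z : Defs.C) : RC := Complex (fst z) (snd z).

Lemma toC_inj : injective toC.
Proof. by case=> a b [c d] [-> ->]. Qed.

Lemma toCD z w : toC (Cadd z w) = toC z + toC w. Proof. by []. Qed.
Lemma toCM z w : toC (Cmul z w) = toC z * toC w. Proof. by []. Qed.
Lemma toCN z : toC (Copp z) = - toC z. Proof. by []. Qed.
Lemma toC0 : toC Defs.C0 = 0. Proof. by []. Qed.
Lemma toC1 : toC Defs.C1 = 1. Proof. by []. Qed.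

Lemma toC_Csum n f : toC (Csum n f) = \sum_(i < n) toC (f i).
Proof.
(* The starting index 0 of [seq] is made explicit so that the induction can generalise it. *)
rewrite /Csum -[RHS](_ : \sum_(i < n) toC (f (0 + i)%N) = _) //.
elim: n 0%N => [|n IHn] m /=; first by rewrite big_ord0.
rewrite toCD IHn big_ord_recl addn0; congr (_ + _).
by apply: eq_bigr => i _; rewrite addnS addSn.
Qed.

Lemma toC_Cprod (f : nat -> Defs.C) n :
  toC (fold_right Cmul Defs.C1 (List.map f (List.seq 0 n))) = \prod_(i < n) toC (f i).
Proof.
rewrite -[RHS](_ : \prod_(i < n) toC (f (0 + i)%N) = _) //.
elim: n 0%N => [|n IHn] m /=; first by rewrite big_ord0.
rewrite toCM IHn big_ord_recl addn0; congr (_ * _).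
by apply: eq_bigr => i _; rewrite addnS addSn.
Qed.

Definition mx_of n (M : Mat) : 'M[RC]_n := \matrix_(i, j) toC (M i j).

(** Both sides expand along row 0: the column skipping of [minor0] is [bump], and the alternating
    sign is that of the cofactor. *)
Lemma toC_det n M : toC (det n M) = \det (mx_of n M).
Proof.
elim: n M => [|n IHn] M; first by rewrite det_mx00.
rewrite (expand_det_row _ ord0) [det _ _]/= toC_Csum.
apply: eq_bigr => j _; rewrite !toCM mxE mulrCA; congr (_ * _).
rewrite /cofactor add0n IHn; congr (_ * _).
  have -> : Nat.even j = ~~ odd j.
    by elim: (nat_of_ord j) => // m IHm; rewrite Nat.even_succ -Nat.negb_even IHm.
  by rewrite -signr_odd; case: odd.
congr (\det _); apply/matrixP => i k; rewrite !mxE /minor0 /= /bump.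
congr (toC (M _ _)); case: Nat.ltb_spec => [/ltP|/leP].
  by rewrite ltnNge => /negbTE->.
by move=> ->.
Qed.

Lemma Nat_divE i q : Nat.div i q = (i %/ q)%N.
Proof.
case: q => [|q]; first by rewrite divn0.
apply: esym; apply: (Nat.div_unique _ _ _ (i %% q.+1)).
  by apply/ltP; rewrite ltn_mod.
by rewrite {1}(divn_eq i q.+1) mulnC.
Qed.

Lemma Nat_modE i q : Nat.modulo i q = (i %% q)%N.
Proof.
case: q => [|q]; first by rewrite modn0.
apply: esym; apply: (Nat.mod_unique _ _ (i %/ q.+1)).
  by apply/ltP; rewrite ltn_mod.
by rewrite {1}(divn_eq i q.+1) mulnC.
Qed.

Lemma Nat_eqbE (i k : nat) : Nat.eqb i k = (i == k).
Proof. by apply/Nat.eqb_spec/eqP. Qed.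

Lemma toC_ind b : toC (Defs.ind b) = b%:R.
Proof. by case: b. Qed.

Definition expC (t : Rdefinitions.R) : RC := toC (Cexpi t).

Lemma expC_INR n x : expC (Rmult (INR n) x) = expC x ^+ n.
Proof.
elim: n => [|n IHn].
  by rewrite expr0 /expC Rmult_0_l Cexpi_0.
by rewrite /expC Cexpi_INR_S toCM exprS; congr (_ * _); exact: IHn.
Qed.

Lemma expC_mulN x : expC x * expC (Ropp x) = 1.
Proof. by rewrite /expC -toCM -Cexpi_add Rplus_opp_r Cexpi_0. Qed.

(* This also covers the cases r = 1, 2, where the entries of the generic pattern overlap. *)
Lemma toC_Delta r theta n k : (n < r)%N -> (k < r)%N ->
  toC (Defs.Delta r theta n k) =
    ((n == 0%N) && (k == r.-1))%:R * expC (Ropp theta)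
    + ((n == r.-1) && (k == 0%N))%:R * expC theta
    + (k == n.+1)%:R + ((0 < n)%N && (k == n.-1))%:R.
Proof.
case: r => [|[|[|r]]] // Hn Hk.
- case: n Hn => [|//] _; case: k Hk => [|//] _.
  by rewrite /= Cexpi_2cos toCD !mul1r !addr0 addrC.
- case: n Hn => [|[|//]] _; case: k Hk => [|[|//]] _;
    by rewrite /= ?toCD ?toC1 ?toC0 ?mul1r ?mul0r ?add0r ?addr0 // addrC.
have -> : (0 < n)%N && (k == n.-1) = (n == k.+1).
  by case: n {Hn} => [|n] //=; rewrite eqSS eq_sym.
rewrite /Defs.Delta [Nat.sub _ _]/= !Nat_eqbE ?subn1 /=.
by do 6?case: eqP => ? /=; rewrite ?mul0r ?mul1r ?add0r ?addr0 ?toC1 ?toC0 //; exfalso; lia.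
Qed.

(** The index c may lie outside the range: the right neighbour of the last site does, and there the
    sum must vanish. *)
Lemma sum_pick r c (F : nat -> RC) :
  \sum_(k < r) (k == c :> nat)%:R * F k = (c < r)%N%:R * F c.
Proof.
case: ltnP => Hc.
  rewrite (bigD1 (Ordinal Hc)) //= eqxx big1 ?addr0 // => k.
  by rewrite -val_eqE /= => /negbTE->; rewrite mul0r.
rewrite mul0r big1 // => k _; case: eqP => [Hk|]; last by rewrite mul0r.
by move: (ltn_ord k); rewrite Hk ltnNge Hc.
Qed.

(* By Bloch's condition z^r = e^(i theta) the corner entries continue the neighbour
   relation z^(n-1) + z^(n+1) periodically. *)
Lemma Delta_eigenvector r theta u n : (0 < r)%N -> (n < r)%N ->
  Cexpi (Rmult (INR r) u) = Cexpi theta ->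
  \sum_(k < r) toC (Defs.Delta r theta n k) * expC u ^+ k
    = toC (RtoC (Rmult 2 (cos u))) * expC u ^+ n.
Proof.
move=> Hr Hn Hu.
have Hz : expC theta = expC u ^+ r by rewrite -expC_INR /expC Hu.
have Hw : expC (Ropp theta) = expC (Ropp u) ^+ r.
  rewrite -expC_INR /expC.
  by congr toC; move: Hu; rewrite /Cexpi => -[Hc Hs];
    rewrite Ropp_mult_distr_r_reverse !cos_neg !sin_neg Hc Hs.
set z := expC u in Hz *; set w := expC (Ropp u) in Hw.
have Hzw : z * w = 1 by rewrite /z /w expC_mulN.
rewrite Cexpi_2cos toCD -/(expC u) -/(expC (Ropp u)) -/z -/w.
under eq_bigr => k _ do rewrite toC_Delta // !mulrDl.
rewrite !big_split /= Hz Hw.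
have -> : \sum_(k < r) ((n == 0%N) && (k == r.-1 :> nat))%:R * w ^+ r * z ^+ k
          = (n == 0%N)%:R * w.
  under eq_bigr => k _ do rewrite -mulnb natrM -!mulrA.
  rewrite -mulr_sumr (sum_pick r r.-1 (fun k => w ^+ r * z ^+ k)) prednK // leqnn mul1r.
  congr (_ * _); rewrite -{1}(prednK Hr) exprS -mulrA -exprMn mulrC.
  by rewrite [w * z]mulrC Hzw expr1n mul1r.
have -> : \sum_(k < r) ((n == r.-1) && (k == 0%N :> nat))%:R * z ^+ r * z ^+ k
          = (n == r.-1)%:R * z ^+ r.
  under eq_bigr => k _ do rewrite -mulnb natrM -!mulrA.
  by rewrite -mulr_sumr (sum_pick r 0 (fun k => z ^+ r * z ^+ k)) Hr mul1r expr0 mulr1.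
have -> : \sum_(k < r) ((0 < n)%N && (k == n.-1 :> nat))%:R * z ^+ k
          = (0 < n)%N%:R * z ^+ n.-1.
  under eq_bigr => k _ do rewrite -mulnb natrM -!mulrA.
  rewrite -mulr_sumr (sum_pick r n.-1 (fun k => z ^+ k)).
  by rewrite (leq_ltn_trans (leq_pred n) Hn) mul1r.
rewrite (sum_pick r n.+1 (fun k => z ^+ k)).
have H1 : (n == r.-1)%:R * z ^+ r + (n.+1 < r)%N%:R * z ^+ n.+1 = z * z ^+ n.
  rewrite -exprS; have [->|Hne] := eqVneq n r.-1.
    by rewrite prednK // ltnn mul1r mul0r addr0.
  rewrite mul0r add0r; have -> : (n.+1 < r)%N; last by rewrite mul1r.
  by rewrite ltn_neqAle Hn andbT -(prednK Hr) eqSS.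
have H2 : (n == 0%N)%:R * w + (0 < n)%N%:R * z ^+ n.-1 = w * z ^+ n.
  case: n {Hn H1} => [|n] /=; first by rewrite mul1r mul0r addr0 mulr1.
  by rewrite mul0r mul1r add0r exprS mulrA [w * z]mulrC Hzw mul1r.
by rewrite mulrDl -H1 -H2 -[X in X + _ = _]addrA [X in X + _ = _]addrC [RHS]addrA.
Qed.

Lemma sum_divmod p q (F : nat -> nat -> RC) :
  \sum_(i < p * q) F (i %/ q)%N (i %% q)%N = \sum_(a < p) \sum_(b < q) F a b.
Proof.
elim: p F => [|p IHp] F; first by rewrite !big_ord0.
rewrite [LHS](_ : _ = \sum_(i < q + p * q) F (i %/ q)%N (i %% q)%N) //.
rewrite big_split_ord big_ord_recl /=; congr (_ + _).
  by apply: eq_bigr => b _; rewrite divn_small // modn_small.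
rewrite -(IHp (fun a => F a.+1)); apply: eq_bigr => i _.
have Hq : (0 < q)%N.
  by have := leq_ltn_trans (leq0n i) (ltn_ord i); rewrite muln_gt0 => /andP[].
by rewrite divnDl // divnn Hq add1n modnDl.
Qed.

(** For k <> k' this is a geometric sum whose ratio is an r-th root of unity other than 1;
    multiplying by the ratio minus 1 telescopes it to 0. *)
Lemma geometric_orthogonality r (u : nat -> Rdefinitions.R) theta k k' :
  (forall k, Cexpi (Rmult (INR r) (u k)) = Cexpi theta) ->
  (forall k k', (k < r)%N -> (k' < r)%N -> k <> k' ->
    Cexpi (Rminus (u k') (u k)) <> Defs.C1) ->
  (k < r)%N -> (k' < r)%N ->
  \sum_(n < r) expC (Ropp (u k)) ^+ n * expC (u k') ^+ n = (k == k')%:R * r%:R.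
Proof.
move=> Hu Hne Hk Hk'.
under eq_bigr => n _ do rewrite -exprMn.
case: eqP => [->|Hkk'].
  rewrite [_ * expC _]mulrC expC_mulN mul1r.
  by under eq_bigr => n _ do rewrite expr1n; rewrite sumr_const card_ord.
rewrite mul0r; set z := _ * _.
have Hz : z = toC (Cexpi (Rminus (u k') (u k))).
  by rewrite /z mulrC /expC -toCM -Cexpi_add.
have Hz1 : z - 1 != 0.
  by rewrite subr_eq0 Hz; apply/eqP => /(@toC_inj _ Defs.C1); apply: Hne.
have Hzr : z ^+ r = 1.
  rewrite /z exprMn -!expC_INR.
  have -> : expC (Rmult (INR r) (u k')) = expC (Rmult (INR r) (u k)).
    by rewrite /expC !Hu.
  by rewrite Ropp_mult_distr_r_reverse mulrC expC_mulN.
apply/eqP; rewrite -(mulrI_eq0 _ (lregP Hz1)).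
by rewrite -subrX1 Hzr subrr.
Qed.

(** A product of Bloch vectors is an eigenvector of each Kronecker summand: the identity factor
    collapses one of the two sums, and [Delta_eigenvector] evaluates the other. *)
Lemma LapGamma_eigenvector p q theta phi u v i : (0 < p)%N -> (0 < q)%N -> (i < p * q)%N ->
  Cexpi (Rmult (INR p) u) = Cexpi theta -> Cexpi (Rmult (INR q) v) = Cexpi phi ->
  \sum_(k < p * q) toC (LapGamma p q theta phi i k) *
      (expC u ^+ (k %/ q) * expC v ^+ (k %% q))
  = toC (RtoC (Rplus (Rmult 2 (cos u)) (Rmult 2 (cos v)))) *
      (expC u ^+ (i %/ q) * expC v ^+ (i %% q)).
Proof.
move=> Hp Hq Hi Hu Hv.
have Hdiv : (i %/ q < p)%N by rewrite ltn_divLR.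
have Hmod : (i %% q < q)%N by rewrite ltn_mod.
pose X a := toC (Defs.Delta p theta (i %/ q)%N a) * expC u ^+ a.
pose Y b := toC (Defs.Delta q phi (i %% q)%N b) * expC v ^+ b.
pose H a b := (b == (i %% q)%N)%:R * expC v ^+ b * X a
              + (a == (i %/ q)%N)%:R * expC u ^+ a * Y b.
rewrite (eq_bigr (fun k : 'I_(p * q) => H (k %/ q)%N (k %% q)%N)); last first.
  move=> k _; rewrite /LapGamma !Nat_divE !Nat_modE toCD !toCM !toC_ind !Nat_eqbE /H /X /Y.
  rewrite [(i %% q)%N == _]eq_sym [(i %/ q)%N == _]eq_sym mulrDl; congr (_ + _).
    by rewrite mulrACA mulrC.
  by rewrite mulrACA.
rewrite sum_divmod /H.
under eq_bigr => a _ do rewrite big_split /= -mulr_suml -mulr_sumr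
  (sum_pick q _ (fun b => expC v ^+ b)) Hmod mul1r.
rewrite big_split /= -mulr_sumr -mulr_suml (sum_pick p _ (fun a => expC u ^+ a)) Hdiv mul1r.
rewrite /X /Y (Delta_eigenvector _ _ _ _ Hp Hdiv Hu) (Delta_eigenvector _ _ _ _ Hq Hmod Hv).
have -> a b : toC (RtoC (Rplus a b)) = toC (RtoC a) + toC (RtoC b).
  by rewrite -toCD /Cadd /RtoC /= Rplus_0_l.
by rewrite mulrDl; congr (_ + _); [rewrite mulrC -mulrA | rewrite mulrCA].
Qed.

(** The columns of F are the Bloch eigenvectors and G is its conjugate transpose. Orthogonality
    gives G F = pq I, so det F is nonzero and can be cancelled from det A det F = det F det (diag
    d). *)
Lemma charpoly p q theta phi theta' phi' x : (0 < p)%N -> (0 < q)%N ->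
  cos theta' = cos theta -> cos phi' = cos phi ->
  det (p * q)%N (shiftMat x (LapGamma p q theta' phi')) =
  fold_right Cmul Defs.C1
    (List.map (fun lam => RtoC (Rminus x lam))
       (List.map (eig p q theta phi) (List.seq 0 (p * q)))).
Proof.
move=> Hp Hq Hth Hph.
have [u [Hu [Hcu Hneu]]] := Bloch_phases p theta theta' (elimT ltP Hp) Hth.
have [v [Hv [Hcv Hnev]]] := Bloch_phases q phi phi' (elimT ltP Hq) Hph.
have {}Hneu k k' : (k < p)%N -> (k' < p)%N -> k <> k' -> _ :=
  fun H H' => Hneu k k' (elimT ltP H) (elimT ltP H').
have {}Hnev k k' : (k < q)%N -> (k' < q)%N -> k <> k' -> _ :=
  fun H H' => Hnev k k' (elimT ltP H) (elimT ltP H').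
apply: toC_inj; rewrite toC_det List.map_map toC_Cprod.
set A := mx_of _ _.
pose F : 'M[RC]_(p * q) := \matrix_(i, j)
  (expC (u (j %/ q)%N) ^+ (i %/ q) * expC (v (j %% q)%N) ^+ (i %% q)).
pose G : 'M[RC]_(p * q) := \matrix_(j, i)
  (expC (Ropp (u (j %/ q)%N)) ^+ (i %/ q) * expC (Ropp (v (j %% q)%N)) ^+ (i %% q)).
pose d : 'rV[RC]_(p * q) := \row_j toC (RtoC (Rminus x (eig p q theta phi j))).
have ltdiv (i : 'I_(p * q)) : (i %/ q < p)%N by rewrite ltn_divLR.
have ltmod (i : 'I_(p * q)) : (i %% q < q)%N by rewrite ltn_mod.
have HGF : G *m F = ((p * q)%:R)%:M.
  apply/matrixP => j k; rewrite !mxE.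
  under eq_bigr => i _ do rewrite !mxE mulrACA.
  rewrite (sum_divmod p q (fun a b =>
    expC (Ropp (u (j %/ q)%N)) ^+ a * expC (u (k %/ q)%N) ^+ a *
    (expC (Ropp (v (j %% q)%N)) ^+ b * expC (v (k %% q)%N) ^+ b))).
  under eq_bigr => a _ do rewrite -mulr_sumr.
  rewrite -mulr_suml (geometric_orthogonality _ _ _ _ _ Hu Hneu) //.
  rewrite (geometric_orthogonality _ _ _ _ _ Hv Hnev) //.
  rewrite mulrACA -natrM mulnb -natrM mulr_natl; congr (_ *+ _).
  congr nat_of_bool; apply/andP/eqP => [[/eqP H1 /eqP H2]|->]; last by rewrite !eqxx.
  by apply: val_inj; rewrite /= (divn_eq j q) (divn_eq k q) H1 H2.
have HAF : A *m F = F *m diag_mx d.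
  apply/matrixP => i j; rewrite mul_mx_diag !mxE.
  rewrite -/(eig p q theta phi j).
  under eq_bigr => k _.
    rewrite !mxE /shiftMat /Csub toCD toCN toCM toC_ind Nat_eqbE mulrDl mulNr.
    over.
  rewrite sumrB (LapGamma_eigenvector _ _ _ _ _ _ _ Hp Hq (ltn_ord i) (Hu _) (Hv _)).
  rewrite Hcu Hcv (bigD1 i) //= eqxx mulr1 big1 ?addr0; last first.
    by move=> k; rewrite eq_sym -val_eqE /= => /negbTE->; rewrite mulr0 mul0r.
  rewrite -mulrBl mulrC; congr (_ * _).
  rewrite -toCN -toCD /eig Nat_divE Nat_modE.
  by rewrite /Cadd /Copp /RtoC /= Ropp_0 Rplus_0_l.
have HdetF : \det F != 0.
  apply/eqP => detF0; have := congr1 determinant HGF.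
  rewrite det_mulmx detF0 mulr0 det_scalar => /esym/eqP.
  by rewrite expf_eq0 Num.Theory.pnatr_eq0 muln_eq0 (gtn_eqF Hp) (gtn_eqF Hq) andbF.
apply: (mulIf HdetF); rewrite -det_mulmx HAF det_mulmx mulrC det_diag.
by congr (_ * _); apply: eq_bigr => i _; rewrite mxE.
Qed.

End CharPoly.

(** The interface to the rest of the proof, which uses the Stdlib order on [nat]. *)
Lemma charpoly_LapGamma p q theta phi theta' phi' x :
  (0 < p)%nat -> (0 < q)%nat ->
  cos theta' = cos theta -> cos phi' = cos phi ->
  det (p * q) (shiftMat x (LapGamma p q theta' phi')) =
  fold_right Cmul Defs.C1
    (map (fun lam => RtoC (x - lam)) (map (eig p q theta phi) (seq 0 (p * q)))).
Proof.
  intros Hp Hq Hth Hph.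
  exact (CharPoly.charpoly p q theta phi theta' phi' x
    (ssrbool.introT ssrnat.ltP Hp) (ssrbool.introT ssrnat.ltP Hq) Hth Hph).
Qed.

(** * Sorted lists of reals *)

Fixpoint insert_R (a : R) (l : list R) : list R :=
  match l with
  | nil => a :: nil
  | b :: l' => if Rle_dec a b then a :: l else b :: insert_R a l'
  end.

Definition sort_R (l : list R) : list R := fold_right insert_R nil l.

Lemma insert_R_perm a l : Permutation (a :: l) (insert_R a l).
Proof.
  induction l as [|b l IH]; simpl; [reflexivity|].
  destruct (Rle_dec a b); [reflexivity|].
  rewrite perm_swap. now rewrite IH.
Qed.

Lemma sort_R_perm l : Permutation l (sort_R l).
Proof.
  induction l as [|a l IH]; simpl; [reflexivity|].
  rewrite <- insert_R_perm. now rewrite <- IH.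
Qed.

Lemma insert_R_sorted a l : StronglySorted Rle l -> StronglySorted Rle (insert_R a l).
Proof.
  induction 1 as [|b l Hl IH Hb]; simpl.
  - repeat constructor.
  - destruct (Rle_dec a b) as [Hab|Hab].
    + constructor; [now constructor|]. constructor; [exact Hab|].
      eapply Forall_impl; [|exact Hb]. intros c Hc; simpl in Hc; lra.
    + constructor; [exact IH|].
      apply (Permutation_Forall (insert_R_perm a l)). constructor; [lra|exact Hb].
Qed.

Lemma sort_R_sorted l : StronglySorted Rle (sort_R l).
Proof. induction l; simpl; [constructor|now apply insert_R_sorted]. Qed.

Definition count {A : Type} (P : A -> bool) (l : list A) : nat := length (filter P l).

Lemma count_perm {A : Type} (P : A -> bool) l l' :
  Permutation l l' -> count P l = count P l'.
Proof.
  unfold count. induction 1; simpl; try congruence;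
    repeat destruct (P _); simpl; congruence.
Qed.

Lemma count_map {A B : Type} (P : B -> bool) (f : A -> B) l :
  count P (map f l) = count (fun x => P (f x)) l.
Proof.
  unfold count. induction l; simpl; [reflexivity|]. destruct (P (f a)); simpl; congruence.
Qed.

Lemma count_cons {A : Type} (P : A -> bool) a l :
  count P (a :: l) = (Nat.b2n (P a) + count P l)%nat.
Proof. unfold count; simpl. now destruct (P a). Qed.

Lemma count_mono {A : Type} (P Q : A -> bool) l :
  (forall x, In x l -> P x = true -> Q x = true) -> (count P l <= count Q l)%nat.
Proof.
  induction l as [|a l IH]; intros H; [apply Nat.le_refl|].
  rewrite !count_cons. specialize (IH (fun x Hx => H x (or_intror Hx))).
  specialize (H a (or_introl eq_refl)).
  destruct (P a); [rewrite H by reflexivity|]; simpl; lia.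
Qed.

Lemma count_le_length {A : Type} (P : A -> bool) l : (count P l <= length l)%nat.
Proof. apply filter_length_le. Qed.

Lemma count_pair_le {A : Type} (P1 P2 Q1 Q2 : A -> bool) l :
  (forall x, In x l ->
     Nat.b2n (Q1 x) + Nat.b2n (Q2 x) <= Nat.b2n (P1 x) + Nat.b2n (P2 x))%nat ->
  (count Q1 l + count Q2 l <= count P1 l + count P2 l)%nat.
Proof.
  induction l as [|a l IH]; intros H; [apply Nat.le_refl|].
  rewrite !count_cons. specialize (IH (fun x Hx => H x (or_intror Hx))).
  specialize (H a (or_introl eq_refl)). lia.
Qed.

(** Two predicates on each side, one for each end of a segment: only their sums are compared element
    by element, not the single predicates. *)
Lemma count_pair_lt {A : Type} (P1 P2 Q1 Q2 : A -> bool) l :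
  (forall x, In x l ->
     Nat.b2n (Q1 x) + Nat.b2n (Q2 x) <= Nat.b2n (P1 x) + Nat.b2n (P2 x))%nat ->
  (exists x, In x l /\
     Nat.b2n (Q1 x) + Nat.b2n (Q2 x) < Nat.b2n (P1 x) + Nat.b2n (P2 x))%nat ->
  (count Q1 l + count Q2 l < count P1 l + count P2 l)%nat.
Proof.
  intros H [x [Hx Hlt]]. apply in_split in Hx. destruct Hx as [l1 [l2 ->]].
  assert (H1 := count_pair_le P1 P2 Q1 Q2 (l1 ++ l2)).
  unfold count in *. rewrite !filter_app, !length_app in *. simpl.
  assert (Hc : forall P : A -> bool, length (if P x then x :: filter P l2 else filter P l2)
             = (Nat.b2n (P x) + length (filter P l2))%nat) by (intros P; now destruct (P x)).
  rewrite !Hc. enough (forall y, In y (l1 ++ l2) ->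
    Nat.b2n (Q1 y) + Nat.b2n (Q2 y) <= Nat.b2n (P1 y) + Nat.b2n (P2 y))%nat as H2
    by (specialize (H1 H2); lia).
  intros y Hy. apply H. apply in_app_iff in Hy. apply in_app_iff. simpl. tauto.
Qed.

(** Since P is downward closed, the elements satisfying it form an initial segment of the sorted
    list. Strict and weak thresholds are both instances. *)
Lemma nth_sorted_count (P : R -> bool) l j :
  (forall x y, x <= y -> P y = true -> P x = true) ->
  StronglySorted Rle l -> (j < length l)%nat ->
  P (nth j l 0) = true <-> (j < count P l)%nat.
Proof.
  intros HP Hl; revert j. induction Hl as [|a l Hl IH Ha]; intros j Hj; simpl in Hj; [lia|].
  rewrite count_cons. destruct (P a) eqn:Pa; cbn [Nat.b2n].
  - destruct j as [|j]; simpl; [split; [lia|auto]|]. rewrite IH by lia. lia.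
  - assert (Hno : forall x, In x l -> P x = false).
    { intros x Hx. destruct (P x) eqn:Px; [|reflexivity].
      rewrite Forall_forall in Ha. rewrite (HP a x (Ha x Hx) Px) in Pa; discriminate. }
    assert (H0 : count P l = 0%nat).
    { clear - Hno. induction l as [|b l IH]; [reflexivity|]. rewrite count_cons.
      rewrite (Hno b (or_introl eq_refl)). apply IH. intros x Hx. apply Hno. now right. }
    rewrite H0. split; [|lia]. destruct j as [|j]; simpl; [congruence|].
    rewrite Hno; [discriminate|]. apply nth_In; lia.
Qed.

Definition ltb_R (c x : R) : bool := if Rlt_dec x c then true else false.
Definition leb_R (c x : R) : bool := if Rle_dec x c then true else false.

Lemma ltb_R_true c x : ltb_R c x = true <-> x < c.
Proof. unfold ltb_R; destruct (Rlt_dec x c); split; try easy; lra. Qed.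

Lemma leb_R_true c x : leb_R c x = true <-> x <= c.
Proof. unfold leb_R; destruct (Rle_dec x c); split; try easy; lra. Qed.

Lemma nth_sort_lt l j c : (j < length l)%nat ->
  nth j (sort_R l) 0 < c <-> (j < count (ltb_R c) l)%nat.
Proof.
  intros Hj. rewrite (count_perm _ _ _ (sort_R_perm l)), <- ltb_R_true.
  apply nth_sorted_count.
  - intros x y; rewrite !ltb_R_true; lra.
  - apply sort_R_sorted.
  - now rewrite <- (Permutation_length (sort_R_perm l)).
Qed.

Lemma nth_sort_le l j c : (j < length l)%nat ->
  nth j (sort_R l) 0 <= c <-> (j < count (leb_R c) l)%nat.
Proof.
  intros Hj. rewrite (count_perm _ _ _ (sort_R_perm l)), <- leb_R_true.
  apply nth_sorted_count.
  - intros x y; rewrite !leb_R_true; lra.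
  - apply sort_R_sorted.
  - now rewrite <- (Permutation_length (sort_R_perm l)).
Qed.

(** A perturbation bound of Weyl type: every index with g at most c has f at most c + d, so at least
    as many values of f lie below the shifted threshold. *)
Lemma nth_sort_map_le (f g : nat -> R) (s : list nat) j d :
  (j < length s)%nat -> (forall i, In i s -> f i <= g i + d) ->
  nth j (sort_R (map f s)) 0 <= nth j (sort_R (map g s)) 0 + d.
Proof.
  intros Hj H. apply nth_sort_le; [now rewrite length_map|].
  set (c := nth j (sort_R (map g s)) 0).
  assert (Hc : (j < count (leb_R c) (map g s))%nat).
  { apply nth_sort_le; [now rewrite length_map|]. unfold c; lra. }
  eapply Nat.lt_le_trans; [exact Hc|]. rewrite !count_map. apply count_mono.
  intros i Hi. rewrite !leb_R_true. specialize (H i Hi). lra.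
Qed.

Lemma continuity_nth_sort (f : nat -> R -> R) (s : list nat) j :
  (j < length s)%nat -> (forall i, continuity (f i)) ->
  continuity (fun t => nth j (sort_R (map (fun i => f i t) s)) 0).
Proof.
  intros Hj Hf t eps Heps.
  assert (Hd : exists d, d > 0 /\ forall t', Rabs (t' - t) < d ->
             forall i, In i s -> Rabs (f i t' - f i t) < eps / 2).
  { clear Hj. induction s as [|i s [d [Hd H]]].
    - exists 1. split; [lra|]. intros t' _ i [].
    - destruct (Hf i t (eps / 2)) as [d' [Hd' H']]; [lra|].
      exists (Rmin d d'). split; [now apply Rmin_pos|].
      intros t' Ht' k [<-|Hk].
      (* The limit in [continuity] only tests points different from t. *)
      + destruct (Req_dec t' t) as [->|Hne].
        * rewrite Rminus_diag, Rabs_R0; lra.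
        * apply H'. repeat split; [congruence|].
          eapply Rlt_le_trans; [exact Ht'|apply Rmin_r].
      + apply H; [|exact Hk]. eapply Rlt_le_trans; [exact Ht'|apply Rmin_l]. }
  destruct Hd as [d [Hd H]]. exists d. split; [exact Hd|].
  intros t' [_ Ht']. specialize (H t' Ht'). simpl. unfold Rdist.
  assert (H1 := nth_sort_map_le (fun i => f i t') (fun i => f i t) s j (eps / 2) Hj).
  assert (H2 := nth_sort_map_le (fun i => f i t) (fun i => f i t') s j (eps / 2) Hj).
  cbv beta in H1, H2.
  match type of H1 with ?P -> _ => assert P as K1 end.
  { intros i Hi. specialize (H i Hi). apply Rabs_def2 in H. lra. }
  match type of H2 with ?P -> _ => assert P as K2 end.
  { intros i Hi. specialize (H i Hi). apply Rabs_def2 in H. lra. }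
  specialize (H1 K1). specialize (H2 K2).
  apply Rabs_def1; lra.
Qed.

(** * Crossing an energy *)

Lemma fold_Cmul_perm (l l' : list Defs.C) :
  Permutation l l' -> fold_right Cmul Defs.C1 l = fold_right Cmul Defs.C1 l'.
Proof.
  induction 1; simpl; try congruence.
  unfold Cmul; simpl. f_equal; ring.
Qed.

(* The charpoly depends on the angles only through their cosines, so an arbitrary pair of
   angles may be folded into [0, PI]^2. *)
Lemma band_nth_eig p q theta phi j : (0 < p)%nat -> (0 < q)%nat ->
  band p q (S j) (nth j (sort_R (map (eig p q theta phi) (seq 0 (p * q)))) 0).
Proof.
  intros Hp Hq. exists (acos (cos theta)), (acos (cos phi)).
  split; [apply acos_bound|]. split; [apply acos_bound|].
  eexists. split; [|simpl; rewrite Nat.sub_0_r; reflexivity].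
  assert (Hperm := sort_R_perm (map (eig p q theta phi) (seq 0 (p * q)))).
  split; [|split].
  - rewrite <- (Permutation_length Hperm), length_map, length_seq. reflexivity.
  - apply StronglySorted_Sorted, sort_R_sorted.
  - intros x. rewrite (charpoly_LapGamma p q theta phi);
      [|exact Hp|exact Hq|apply cos_acos, COS_bound|apply cos_acos, COS_bound].
    apply fold_Cmul_perm, Permutation_map, Hperm.
Qed.

Lemma continuity_eig_line p q theta phi a b i :
  continuity (fun t => eig p q (theta + a * t) (phi + b * t) i).
Proof. unfold eig, angle. reg. Qed.

(** Let j be the number of eigenvalues at most E at A. The sorted eigenvalue with zero-based index j
    exceeds E at A and is below E at B. By continuity along the segment from A to B it takes all
    values in between. *)
Lemma count_crossing p q thetaA phiA thetaB phiB E : (0 < p)%nat -> (0 < q)%nat ->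
  (count (leb_R E) (map (eig p q thetaA phiA) (seq 0 (p * q)))
   < count (ltb_R E) (map (eig p q thetaB phiB) (seq 0 (p * q))))%nat ->
  exists j, (1 <= j <= p * q)%nat /\ int_R (band p q j) E.
Proof.
  intros Hp Hq. set (lA := map (eig p q thetaA phiA) _). set (lB := map (eig p q thetaB phiB) _).
  intros Hlt. set (j := count (leb_R E) lA).
  assert (Hj : (j < p * q)%nat).
  { eapply Nat.lt_le_trans; [exact Hlt|].
    eapply Nat.le_trans; [apply count_le_length|].
    unfold lB; rewrite length_map, length_seq. apply Nat.le_refl. }
  assert (HA : E < nth j (sort_R lA) 0).
  { apply Rnot_le_lt. intros H. apply nth_sort_le in H.
    - revert H. apply Nat.lt_irrefl.
    - unfold lA. now rewrite length_map, length_seq. }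
  assert (HB : nth j (sort_R lB) 0 < E).
  { apply nth_sort_lt; [|exact Hlt]. unfold lB. now rewrite length_map, length_seq. }
  (* Bands are numbered from 1, list positions from 0. *)
  exists (S j). split; [lia|].
  set (vA := nth j (sort_R lA) 0) in *. set (vB := nth j (sort_R lB) 0) in *.
  exists (Rmin (vA - E) (E - vB)). split; [apply Rmin_pos; lra|].
  intros y Hy. apply Rabs_def2 in Hy.
  assert (H1 := Rmin_l (vA - E) (E - vB)). assert (H2 := Rmin_r (vA - E) (E - vB)).
  set (F := fun t : R => nth j (sort_R (map (fun i =>
    eig p q (thetaA + (thetaB - thetaA) * t) (phiA + (phiB - phiA) * t) i)
    (seq 0 (p * q)))) 0 - y).
  assert (HF : continuity F).
  { unfold F. apply (continuity_minus _ (fun _ => y)).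
    - apply (continuity_nth_sort (fun i t =>
        eig p q (thetaA + (thetaB - thetaA) * t) (phiA + (phiB - phiA) * t) i)).
      + now rewrite length_seq.
      + intros i. apply continuity_eig_line.
    - apply continuity_const. intros ? ?; reflexivity. }
  assert (F0 : F 0 = vA - y).
  { unfold F, vA, lA. rewrite !Rmult_0_r, !Rplus_0_r. reflexivity. }
  assert (F1 : F 1 = vB - y).
  { unfold F, vB, lB. rewrite !Rmult_1_r, !Rplus_minus. reflexivity. }
  destruct (IVT_cor F 0 1 HF) as [z [_ Hz]]; [lra|rewrite F0, F1; nra|].
  replace y with (nth j (sort_R (map (eig p q (thetaA + (thetaB - thetaA) * z)
    (phiA + (phiB - phiA) * z)) (seq 0 (p * q)))) 0).
  - now apply band_nth_eig.
  - unfold F in Hz. apply Rminus_diag_uniq in Hz. exact Hz.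
Qed.


(** * Eigenvalues along lines through a base point *)

Definition near0 (P : R -> Prop) : Prop := exists d, 0 < d /\ forall t, 0 < t < d -> P t.

Lemma near0_and P Q : near0 P -> near0 Q -> near0 (fun t => P t /\ Q t).
Proof.
  intros [d [Hd H]] [d' [Hd' H']]. exists (Rmin d d').
  split; [now apply Rmin_pos|]. intros t Ht.
  assert (H1 := Rmin_l d d'). assert (H2 := Rmin_r d d').
  split; [apply H|apply H']; lra.
Qed.

Lemma near0_impl (P Q : R -> Prop) : (forall t, 0 < t -> P t -> Q t) -> near0 P -> near0 Q.
Proof. intros HPQ [d [Hd H]]. exists d. split; [exact Hd|]. intros t Ht. apply HPQ; [lra|auto]. Qed.

Lemma near0_forall n (P : nat -> R -> Prop) :
  (forall i, (i < n)%nat -> near0 (P i)) -> near0 (fun t => forall i, (i < n)%nat -> P i t).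
Proof.
  induction n as [|n IH]; intros H.
  - exists 1. split; [lra|]. intros t _ i Hi; lia.
  - assert (Hn := near0_and _ _ (IH (fun i Hi => H i (Nat.lt_lt_succ_r _ _ Hi)))
                    (H n (Nat.lt_succ_diag_r n))).
    revert Hn. apply near0_impl. intros t _ [H1 H2] i Hi.
    destruct (Nat.eq_dec i n) as [->|Hin]; [exact H2|]. apply H1; lia.
Qed.

Lemma near0_ex P : near0 P -> exists t, 0 < t /\ P t.
Proof. intros [d [Hd H]]. exists (d / 2). split; [lra|]. apply H; lra. Qed.

(** In the next four predicates, [one] means at least one end. Thus [one_lt] bounds the number of
    ends strictly below E from below by 1, and [one_gt] bounds the number of ends at or below E from
    above by 1. *)
Definition both_lt (g : R -> R) (E t : R) : Prop := g t < E /\ g (- t) < E.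
Definition both_gt (g : R -> R) (E t : R) : Prop := E < g t /\ E < g (- t).
Definition one_lt (g : R -> R) (E t : R) : Prop := g t < E \/ g (- t) < E.
Definition one_gt (g : R -> R) (E t : R) : Prop := E < g t \/ E < g (- t).

Lemma continuity_near0 g e : continuity g -> 0 < e ->
  near0 (fun t => Rabs (g t - g 0) < e /\ Rabs (g (- t) - g 0) < e).
Proof.
  intros Hg He. destruct (Hg 0 e He) as [d [Hd H]].
  exists d. split; [exact Hd|]. intros t Ht.
  split; apply H; (split; [split; [exact I|lra]|]);
    simpl; unfold Rdist; rewrite Rminus_0_r; apply Rabs_def1; lra.
Qed.

Lemma near0_both_lt g E : continuity g -> g 0 < E -> near0 (both_lt g E).
Proof.
  intros Hg H0. generalize (continuity_near0 g (E - g 0) Hg ltac:(lra)).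
  apply near0_impl. intros t _ [H1 H2].
  apply Rabs_def2 in H1, H2. split; lra.
Qed.

Lemma near0_both_gt g E : continuity g -> E < g 0 -> near0 (both_gt g E).
Proof.
  intros Hg H0. generalize (continuity_near0 g (g 0 - E) Hg ltac:(lra)).
  apply near0_impl. intros t _ [H1 H2].
  apply Rabs_def2 in H1, H2. split; lra.
Qed.

Lemma near0_transversal g E l : derivable_pt_lim g 0 l -> l <> 0 -> g 0 = E ->
  near0 (fun t => one_lt g E t /\ one_gt g E t).
Proof.
  intros Hg Hl H0.
  (* With tolerance |l|, the difference quotients at t and at -t both keep the sign of l, so g - E
     has opposite signs at the two ends. *)
  destruct (Hg (Rabs l) (Rabs_pos_lt l Hl)) as [[d Hd] H]; simpl in H.
  exists d. split; [exact Hd|]. intros t Ht.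
  assert (H1 := H t ltac:(lra) ltac:(apply Rabs_def1; lra)).
  assert (H2 := H (- t) ltac:(lra) ltac:(apply Rabs_def1; lra)).
  rewrite Rplus_0_l, H0 in H1, H2.
  set (u := (g t - E) / t) in *. set (v := (g (- t) - E) / - t) in *.
  assert (Hu : g t = E + u * t) by (unfold u; field; lra).
  assert (Hv : g (- t) = E - v * t) by (unfold v; field; lra).
  unfold one_lt, one_gt. rewrite Hu, Hv.
  apply Rabs_def2 in H1, H2.
  destruct (Rtotal_order l 0) as [Hneg|[Hz|Hpos]]; [|contradiction|].
  - rewrite Rabs_left in H1, H2 by exact Hneg.
    assert (0 < - u * t) by (apply Rmult_lt_0_compat; lra).
    assert (0 < - v * t) by (apply Rmult_lt_0_compat; lra).
    split; [left|right]; lra.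
  - rewrite Rabs_right in H1, H2 by lra.
    assert (0 < u * t) by (apply Rmult_lt_0_compat; lra).
    assert (0 < v * t) by (apply Rmult_lt_0_compat; lra).
    split; [right|left]; lra.
Qed.

Definition eig_line (p q : nat) (theta phi a b : R) (i : nat) (t : R) : R :=
  eig p q (theta + a * t) (phi + b * t) i.

Lemma eig_line_0 p q theta phi a b i : eig_line p q theta phi a b i 0 = eig p q theta phi i.
Proof. unfold eig_line. now rewrite !Rmult_0_r, !Rplus_0_r. Qed.

Lemma derivable_pt_lim_eig_line p q theta phi a b i :
  derivable_pt_lim (eig_line p q theta phi a b i) 0
    (-2 * (sin (angle p theta (i / q)) / INR p * a + sin (angle q phi (i mod q)) / INR q * b)).
Proof.
  assert (Haux : forall r psi c k,
    derivable_pt_lim (fun t => 2 * cos (angle r (psi + c * t) k)) 0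
      (2 * (- sin (angle r psi k) * (c / INR r)))).
  { intros r psi c k. apply (derivable_pt_lim_scal (fun t => cos _)).
    apply (derivable_pt_lim_ext (comp cos (fun t => angle r psi k + c / INR r * t))).
    { intros t. unfold comp, angle, Rdiv. f_equal. ring. }
    apply (derivable_pt_lim_comp (fun t => angle r psi k + c / INR r * t) cos).
    - assert (H := derivable_pt_lim_plus (fun _ => angle r psi k) (fun t => c / INR r * t) 0 _ _
        (derivable_pt_lim_const _ 0)
        (derivable_pt_lim_scal (fun t => t) (c / INR r) 0 1 (derivable_pt_lim_id 0))).
      rewrite Rplus_0_l, Rmult_1_r in H. exact H.
    - rewrite Rmult_0_r, Rplus_0_r. apply derivable_pt_lim_cos. }
  replace (-2 * _) with
    (2 * (- sin (angle p theta (i / q)) * (a / INR p))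
     + 2 * (- sin (angle q phi (i mod q)) * (b / INR q))) by (unfold Rdiv; ring).
  apply (derivable_pt_lim_plus (fun t => 2 * cos (angle p (theta + a * t) (i / q)))
           (fun t => 2 * cos (angle q (phi + b * t) (i mod q)))); apply Haux.
Qed.

(* Comparing the two endpoints +t, -t of a line in direction b with those of a line in
   direction a at once makes an eigenvalue that passes transversally through E contribute
   exactly 1 on both sides, so only tangential passages matter. *)
Lemma crossing_lines p q theta phi a1 a2 b1 b2 E : (0 < p)%nat -> (0 < q)%nat ->
  let gA := eig_line p q theta phi a1 a2 in
  let gB := eig_line p q theta phi b1 b2 in
  (forall i, (i < p * q)%nat -> near0 (fun t =>
     both_lt (gB i) E t \/ both_gt (gA i) E t \/ (one_lt (gB i) E t /\ one_gt (gA i) E t))) ->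
  (exists i, (i < p * q)%nat /\ near0 (fun t =>
     (both_lt (gB i) E t /\ one_gt (gA i) E t) \/ (one_lt (gB i) E t /\ both_gt (gA i) E t))) ->
  exists j, (1 <= j <= p * q)%nat /\ int_R (band p q j) E.
Proof.
  intros Hp Hq gA gB Hall [i0 [Hi0 Hstrict]].
  destruct (near0_ex _ (near0_and _ _ (near0_forall _ _ Hall) Hstrict)) as [t [_ [H1 H2]]].
  clear Hall Hstrict.
  assert (Hsum := count_pair_lt
    (fun i => ltb_R E (gB i t)) (fun i => ltb_R E (gB i (- t)))
    (fun i => leb_R E (gA i t)) (fun i => leb_R E (gA i (- t)))
    (seq 0 (p * q))).
  assert (Hcase : forall k, (count (fun i => leb_R E (gA i k)) (seq 0 (p * q))
                             < count (fun i => ltb_R E (gB i k)) (seq 0 (p * q)))%nat ->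
    exists j, (1 <= j <= p * q)%nat /\ int_R (band p q j) E).
  { intros k Hk.
    apply (count_crossing p q (theta + a1 * k) (phi + a2 * k) (theta + b1 * k) (phi + b2 * k));
      [exact Hp|exact Hq|]. rewrite !count_map. exact Hk. }
  (* A strict inequality between the sums over both ends forces a strict inequality at t or at
     -t. *)
  destruct (Nat.lt_ge_cases (count (fun i => leb_R E (gA i t)) (seq 0 (p * q)))
    (count (fun i => ltb_R E (gB i t)) (seq 0 (p * q)))) as [Hlt|Hge]; [now apply (Hcase t)|].
  apply (Hcase (- t)).
  enough (count (fun i => leb_R E (gA i t)) (seq 0 (p * q))
    + count (fun i => leb_R E (gA i (- t))) (seq 0 (p * q))
    < count (fun i => ltb_R E (gB i t)) (seq 0 (p * q))
      + count (fun i => ltb_R E (gB i (- t))) (seq 0 (p * q)))%nat by lia.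
  apply Hsum; clear Hsum Hcase Hge.
  - intros i Hi. apply in_seq in Hi. specialize (H1 i ltac:(lia)).
    unfold both_lt, both_gt, one_lt, one_gt, ltb_R, leb_R in *.
    repeat destruct (Rlt_dec _ _); repeat destruct (Rle_dec _ _); simpl; try lia; exfalso; lra.
  - exists i0. split; [apply in_seq; lia|].
    unfold both_lt, both_gt, one_lt, one_gt, ltb_R, leb_R in *.
    repeat destruct (Rlt_dec _ _); repeat destruct (Rle_dec _ _); simpl; try lia; exfalso; lra.
Qed.

(** * Behaviour of a single eigenvalue near the base point *)

Lemma cos_near_max r psi k : (0 < r)%nat -> cos (angle r psi k) = 1 ->
  near0 (fun t => cos (angle r (psi + 1 * t) k) < 1 /\ cos (angle r (psi + 1 * - t) k) < 1).
Proof.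
  intros Hr H1. apply lt_INR in Hr; simpl in Hr.
  assert (Hs : sin (angle r psi k) = 0).
  { assert (H := sin2_cos2 (angle r psi k)). unfold Rsqr in H. rewrite H1 in H. nra. }
  (* For t < r the angle moves by less than 1, hence by less than a period; as the sine vanishes,
     both new cosines equal cos (t / r). *)
  exists (INR r). split; [exact Hr|]. intros t Ht.
  assert (Hu : 0 < t / INR r < 2 * PI).
  { assert (H2 := PI2_1). split; [apply Rdiv_lt_0_compat; lra|].
    apply Rlt_trans with 1; [|lra]. apply (Rmult_lt_reg_r (INR r)); [exact Hr|].
    field_simplify; lra. }
  apply cos_lt_1 in Hu.
  replace (angle r (psi + 1 * t) k) with (angle r psi k + t / INR r)
    by (unfold angle; field; lra).
  replace (angle r (psi + 1 * - t) k) with (angle r psi k - t / INR r)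
    by (unfold angle; field; lra).
  rewrite cos_plus, cos_minus, H1, Hs. lra.
Qed.

Lemma cos_near_min r psi k : (0 < r)%nat -> cos (angle r psi k) = -1 ->
  near0 (fun t => -1 < cos (angle r (psi + 1 * t) k) /\ -1 < cos (angle r (psi + 1 * - t) k)).
Proof.
  intros Hr H1. assert (Hr' := lt_INR _ _ Hr); simpl in Hr'.
  (* Adding PI r to the quasimomentum adds PI to the angle and turns the minimum into a maximum. *)
  assert (Hpi : forall psi', cos (angle r (psi' + PI * INR r) k) = - cos (angle r psi' k)).
  { intros psi'. rewrite <- neg_cos. f_equal. unfold angle. field. lra. }
  generalize (cos_near_max r (psi + PI * INR r) k Hr). rewrite Hpi.
  intros H. specialize (H ltac:(lra)). revert H. apply near0_impl. intros t _ [H2 H3].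
  replace (psi + PI * INR r + 1 * t) with (psi + 1 * t + PI * INR r) in H2 by ring.
  replace (psi + PI * INR r + 1 * - t) with (psi + 1 * - t + PI * INR r) in H3 by ring.
  rewrite Hpi in H2, H3. lra.
Qed.

Lemma eig_line_fst_max p q theta phi E i : (0 < p)%nat ->
  eig p q theta phi i = E -> cos (angle p theta (i / q)) = 1 ->
  near0 (both_lt (eig_line p q theta phi 1 0 i) E).
Proof.
  intros Hp <- H1. generalize (cos_near_max p theta (i / q) Hp H1).
  apply near0_impl. intros t _ H. unfold both_lt, eig_line, eig.
  rewrite !Rmult_0_l, !Rplus_0_r. lra.
Qed.

Lemma eig_line_snd_max p q theta phi E i : (0 < q)%nat ->
  eig p q theta phi i = E -> cos (angle q phi (i mod q)) = 1 ->
  near0 (both_lt (eig_line p q theta phi 0 1 i) E).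
Proof.
  intros Hq <- H1. generalize (cos_near_max q phi (i mod q) Hq H1).
  apply near0_impl. intros t _ H. unfold both_lt, eig_line, eig.
  rewrite !Rmult_0_l, !Rplus_0_r. lra.
Qed.

Lemma eig_line_snd_min p q theta phi E i : (0 < q)%nat ->
  eig p q theta phi i = E -> cos (angle q phi (i mod q)) = -1 ->
  near0 (both_gt (eig_line p q theta phi 0 1 i) E).
Proof.
  intros Hq <- H1. generalize (cos_near_min q phi (i mod q) Hq H1).
  apply near0_impl. intros t _ H. unfold both_gt, eig_line, eig.
  rewrite !Rmult_0_l, !Rplus_0_r. lra.
Qed.

Lemma eig_line_below p q theta phi a b i E : eig p q theta phi i < E ->
  near0 (both_lt (eig_line p q theta phi a b i) E).
Proof.
  intros H. apply near0_both_lt; [apply continuity_eig_line|]. now rewrite eig_line_0.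
Qed.

Lemma eig_line_above p q theta phi a b i E : E < eig p q theta phi i ->
  near0 (both_gt (eig_line p q theta phi a b i) E).
Proof.
  intros H. apply near0_both_gt; [apply continuity_eig_line|]. now rewrite eig_line_0.
Qed.

Lemma eig_line_transversal p q theta phi a b i E :
  eig p q theta phi i = E ->
  sin (angle p theta (i / q)) / INR p * a + sin (angle q phi (i mod q)) / INR q * b <> 0 ->
  near0 (fun t => one_lt (eig_line p q theta phi a b i) E t
                  /\ one_gt (eig_line p q theta phi a b i) E t).
Proof.
  intros HE Hd. eapply near0_transversal; [apply derivable_pt_lim_eig_line| |].
  - lra.
  - now rewrite eig_line_0.
Qed.

(** * Nonzero energies *)

Lemma cos_of_sin_0 x : sin x = 0 -> cos x = 1 \/ cos x = -1.
Proof.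
  intros H. assert (H1 := sin2_cos2 x). unfold Rsqr in H1. rewrite H in H1.
  assert (H2 : (cos x - 1) * (cos x + 1) = 0) by lra.
  apply Rmult_integral in H2. destruct H2; [left|right]; lra.
Qed.

Lemma sin_of_cos_sqr_1 x : cos x * cos x = 1 -> sin x = 0.
Proof. intros H. assert (H1 := sin2_cos2 x). unfold Rsqr in H1. nra. Qed.

Lemma div_neq0 x y : x <> 0 -> y <> 0 -> x / y <> 0.
Proof. intros Hx Hy. unfold Rdiv. apply Rmult_integral_contrapositive_currified; auto with real. Qed.

(** The gradient never vanishes at an eigenvalue E: if both sines were 0, E would be -4, 0 or 4. For
    each of the finitely many i, every small s > 0 works: it cannot cancel a nonzero
    theta-component, and if that component is 0 the phi-component is not. *)
Lemma generic_direction p q theta phi E : (0 < p)%nat -> (0 < q)%nat ->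
  -4 < E < 4 -> E <> 0 ->
  exists s, forall i, (i < p * q)%nat -> eig p q theta phi i = E ->
    sin (angle p theta (i / q)) / INR p * 1 + sin (angle q phi (i mod q)) / INR q * s <> 0.
Proof.
  intros Hp Hq HE HE0.
  assert (Hp' := lt_0_INR _ Hp). assert (Hq' := lt_0_INR _ Hq).
  assert (H : near0 (fun s => forall i, (i < p * q)%nat -> eig p q theta phi i = E ->
    sin (angle p theta (i / q)) / INR p * 1 + sin (angle q phi (i mod q)) / INR q * s <> 0)).
  { apply near0_forall. intros i _.
    set (x := angle p theta (i / q)). set (y := angle q phi (i mod q)).
    set (g := fun s => sin x / INR p * 1 + sin y / INR q * s).
    assert (Hg : continuity g) by (unfold g; reg).
    assert (Hg0 : g 0 = sin x / INR p) by (unfold g; ring).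
    destruct (Rtotal_order (sin x / INR p) 0) as [Hx|[Hx|Hx]].
    - generalize (near0_both_lt g 0 Hg ltac:(lra)). apply near0_impl.
      intros s _ [H _] _. unfold g in H. lra.
    - exists 1. split; [lra|]. intros s Hs Hi. unfold eig in Hi. fold x y in Hi.
      assert (Hsx : sin x = 0).
      { destruct (Req_dec (sin x) 0) as [H|H]; [exact H|].
        exfalso. revert Hx. apply div_neq0; lra. }
      assert (Hsy : sin y <> 0).
      { intros H. apply cos_of_sin_0 in H, Hsx. destruct H, Hsx; lra. }
      rewrite Hx, Rmult_0_l, Rplus_0_l. apply Rmult_integral_contrapositive_currified; [|lra].
      apply div_neq0; lra.
    - generalize (near0_both_gt g 0 Hg ltac:(lra)). apply near0_impl.
      intros s _ [H _] _. unfold g in H. lra. }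
  destruct (near0_ex _ H) as [s [_ Hs]]. now exists s.
Qed.

(** As c has the sign of E, subtracting it from E / 2, which lies in (-2, 2), lands in (-1, 1). *)
Lemma cos_acos_shift E c : -4 < E < 4 -> 0 < E * c -> c = 1 \/ c = -1 ->
  cos (acos (E / 2 - c)) = E / 2 - c.
Proof. intros HE HEc [-> | ->]; apply cos_acos; lra. Qed.

(* Base point: an eigenvalue 2 cos x + 2 cos y with y = 0 (E > 0) or y = PI (E < 0) equals E.
   Every such eigenvalue moves away from E to the same side along the phi-line,
   whereas a generic line crosses all eigenvalues at E transversally. *)
Lemma band_interior_nonzero p q E : (0 < p)%nat -> (0 < q)%nat -> -4 < E < 4 -> E <> 0 ->
  exists j, (1 <= j <= p * q)%nat /\ int_R (band p q j) E.
Proof.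
  intros Hp Hq HE HE0.
  assert (Hp' := lt_0_INR _ Hp). assert (Hq' := lt_0_INR _ Hq).
  assert (Hp0 : INR p <> 0) by lra. assert (Hq0 : INR q <> 0) by lra.
  assert (Hbase : forall c, 0 < E * c -> c = 1 \/ c = -1 -> exists theta phi,
    eig p q theta phi 0 = E /\ cos (angle q phi (0 mod q)) = c /\
    forall i, eig p q theta phi i = E ->
      sin (angle q phi (i mod q)) = 0 -> cos (angle q phi (i mod q)) = c).
  { intros c HEc Hc.
    (* The factors p and q cancel in [angle] at index 0, so that eigenvalue is 2 (E / 2 - c) + 2 c =
       E. *)
    exists (INR p * acos (E / 2 - c)), (INR q * acos c).
    assert (H0 : forall r x, 0 < INR r -> angle r (INR r * x) 0 = x).
    { intros r x Hr. unfold angle. simpl. field. lra. }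
    assert (Hcc : cos (acos c) = c) by (apply cos_acos; destruct Hc; lra).
    split; [|split].
    - unfold eig. rewrite Nat.Div0.div_0_l, Nat.Div0.mod_0_l, !H0 by assumption.
      rewrite Hcc, cos_acos_shift by assumption. lra.
    - rewrite Nat.Div0.mod_0_l, H0 by assumption. exact Hcc.
    (* The other value, cos y = -c, would force cos x = E / 2 + c, which lies outside [-1, 1]. *)
    - intros i Hi Hs. unfold eig in Hi.
      assert (Hx := COS_bound (angle p (INR p * acos (E / 2 - c)) (i / q))).
      apply cos_of_sin_0 in Hs. destruct Hs as [Hs|Hs], Hc as [-> | ->]; lra. }
  assert (Hpq : (0 < p * q)%nat) by now apply Nat.mul_pos_pos.
  destruct (Rlt_or_le 0 E) as [Hpos|Hneg].
  - destruct (Hbase 1) as [theta [phi [H0 [Hc0 Hc]]]]; [lra|now left|].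
    destruct (generic_direction p q theta phi E Hp Hq HE HE0) as [s Hs].
    (* The phi-line serves as B: tangential eigenvalues are below E at both of its ends. The generic
       line serves as A. *)
    apply (crossing_lines p q theta phi 1 s 0 1 E Hp Hq).
    + intros i Hi. destruct (Rtotal_order (eig p q theta phi i) E) as [HiE|[HiE|HiE]].
      * generalize (eig_line_below p q theta phi 0 1 i E HiE). apply near0_impl. tauto.
      * destruct (Req_dec (sin (angle q phi (i mod q))) 0) as [Hy|Hy].
        -- generalize (eig_line_snd_max p q theta phi E i Hq HiE (Hc i HiE Hy)).
           apply near0_impl. tauto.
        -- assert (HA := eig_line_transversal p q theta phi 1 s i E HiE (Hs i Hi HiE)).
           assert (HB := eig_line_transversal p q theta phi 0 1 i E HiE).
           rewrite Rmult_0_r, Rplus_0_l, Rmult_1_r in HB.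
           specialize (HB (div_neq0 _ _ Hy Hq0)).
           generalize (near0_and _ _ HA HB). apply near0_impl. tauto.
      * generalize (eig_line_above p q theta phi 1 s i E HiE). apply near0_impl. tauto.
    + exists 0%nat. split; [exact Hpq|].
      generalize (near0_and _ _ (eig_line_snd_max p q theta phi E 0 Hq H0 Hc0)
        (eig_line_transversal p q theta phi 1 s 0 E H0 (Hs 0%nat Hpq H0))).
      apply near0_impl. tauto.
  - destruct (Hbase (-1)) as [theta [phi [H0 [Hc0 Hc]]]]; [lra|now right|].
    destruct (generic_direction p q theta phi E Hp Hq HE HE0) as [s Hs].
    (* For E < 0 tangential eigenvalues rise above E along the phi-line, so the two lines exchange
       roles. *)
    apply (crossing_lines p q theta phi 0 1 1 s E Hp Hq).
    + intros i Hi. destruct (Rtotal_order (eig p q theta phi i) E) as [HiE|[HiE|HiE]].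
      * generalize (eig_line_below p q theta phi 1 s i E HiE). apply near0_impl. tauto.
      * destruct (Req_dec (sin (angle q phi (i mod q))) 0) as [Hy|Hy].
        -- generalize (eig_line_snd_min p q theta phi E i Hq HiE (Hc i HiE Hy)).
           apply near0_impl. tauto.
        -- assert (HB := eig_line_transversal p q theta phi 1 s i E HiE (Hs i Hi HiE)).
           assert (HA := eig_line_transversal p q theta phi 0 1 i E HiE).
           rewrite Rmult_0_r, Rplus_0_l, Rmult_1_r in HA.
           specialize (HA (div_neq0 _ _ Hy Hq0)).
           generalize (near0_and _ _ HA HB). apply near0_impl. tauto.
      * generalize (eig_line_above p q theta phi 0 1 i E HiE). apply near0_impl. tauto.
    + exists 0%nat. split; [exact Hpq|].
      generalize (near0_and _ _ (eig_line_snd_min p q theta phi E 0 Hq H0 Hc0)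
        (eig_line_transversal p q theta phi 1 s 0 E H0 (Hs 0%nat Hpq H0))).
      apply near0_impl. tauto.
Qed.

(** * Energy zero *)

Lemma cos_angle_neq_m1 p k : Nat.Odd p -> (k < p)%nat -> cos (angle p 0 k) <> -1.
Proof.
  intros Hodd Hk Hc.
  assert (Hp' : 0 < INR p) by (apply lt_0_INR; lia).
  (* The angle 2 PI k / p equals PI only if 2 k = p, which is impossible for odd p; and PI is the
     only point of [0, 2 PI) with cosine -1. *)
  assert (Hne : PI - angle p 0 k <> 0).
  { intros H. assert (H1 : PI * (2 * INR k) = PI * INR p).
    { replace (PI * INR p) with (PI * INR p - (PI - angle p 0 k) * INR p) by (rewrite H; ring).
      unfold angle. field. lra. }
    apply Rmult_eq_reg_l in H1; [|apply PI_neq0].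
    replace 2 with (INR 2) in H1 by reflexivity.
    rewrite <- mult_INR in H1. apply INR_eq in H1. destruct Hodd as [m Hm]. lia. }
  assert (Hb : 0 <= angle p 0 k < 2 * PI).
  { assert (Hk' := lt_INR _ _ Hk). assert (Hk0 := pos_INR k). assert (H := PI_RGT_0).
    unfold angle. replace ((0 + 2 * PI * INR k) / INR p) with (2 * PI * (INR k / INR p))
      by (field; lra).
    assert (0 <= INR k / INR p < 1).
    { split; [apply Rmult_le_pos; [lra|left; now apply Rinv_0_lt_compat]|].
      apply (Rmult_lt_reg_r (INR p)); [exact Hp'|]. field_simplify; lra. }
    nra. }
  assert (Hc' : cos (angle p 0 k - PI) = 1).
  { rewrite cos_minus, cos_PI, sin_PI, Hc. ring. }
  destruct (Rlt_or_le (angle p 0 k) PI) as [H|H].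
  - rewrite <- cos_neg in Hc'. enough (cos (- (angle p 0 k - PI)) < 1) by lra.
    apply cos_lt_1. lra.
  - enough (cos (angle p 0 k - PI) < 1) by lra. apply cos_lt_1.
    destruct (Rtotal_order (PI - angle p 0 k) 0) as [H'|[H'|H']]; [lra|contradiction|lra].
Qed.

(* At theta = phi = 0 the level set 2 cos x + 2 cos y = 0 meets the lattice of quasimomenta in
   the saddle (0, PI), where the theta-line goes down and the phi-line goes up, and in regular
   points, which both lines cross transversally. The other saddle (PI, 0) is off the lattice,
   as p is odd. *)
Lemma band_interior_zero p q : Nat.Odd p -> (0 < q)%nat -> Nat.Even q ->
  exists j, (1 <= j <= p * q)%nat /\ int_R (band p q j) 0.
Proof.
  intros Hodd Hq [m Hm].
  assert (Hp : (0 < p)%nat) by (destruct Hodd; lia).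
  assert (Hp' := lt_0_INR _ Hp). assert (Hq' := lt_0_INR _ Hq).
  assert (Hp0 : INR p <> 0) by lra. assert (Hq0 : INR q <> 0) by lra.
  apply (crossing_lines p q 0 0 0 1 1 0 0 Hp Hq).
  - intros i Hi. destruct (Rtotal_order (eig p q 0 0 i) 0) as [HiE|[HiE|HiE]].
    + generalize (eig_line_below p q 0 0 1 0 i 0 HiE). apply near0_impl. tauto.
    (* At energy 0 the two cosines are opposite, so the two sines vanish together: the point is
       either a saddle or transversal to both lines. *)
    + assert (Hsq : cos (angle p 0 (i / q)) = - cos (angle q 0 (i mod q)))
        by (unfold eig in HiE; lra).
      destruct (Req_dec (sin (angle p 0 (i / q))) 0) as [Hx|Hx].
      * assert (Hik : (i / q < p)%nat) by (apply Nat.Div0.div_lt_upper_bound; lia).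
        assert (Hm1 := cos_angle_neq_m1 p (i / q) Hodd Hik).
        destruct (cos_of_sin_0 _ Hx) as [H1|H1]; [|contradiction].
        generalize (eig_line_fst_max p q 0 0 0 i Hp HiE H1). apply near0_impl. tauto.
      * assert (Hy : sin (angle q 0 (i mod q)) <> 0).
        { intros Hy. apply Hx, sin_of_cos_sqr_1. rewrite Hsq.
          destruct (cos_of_sin_0 _ Hy) as [-> | ->]; ring. }
        assert (HA := eig_line_transversal p q 0 0 0 1 i 0 HiE).
        rewrite Rmult_0_r, Rplus_0_l, Rmult_1_r in HA.
        specialize (HA (div_neq0 _ _ Hy Hq0)).
        assert (HB := eig_line_transversal p q 0 0 1 0 i 0 HiE).
        rewrite Rmult_0_r, Rplus_0_r, Rmult_1_r in HB.
        specialize (HB (div_neq0 _ _ Hx Hp0)).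
        generalize (near0_and _ _ HA HB). apply near0_impl. tauto.
    + generalize (eig_line_above p q 0 0 0 1 i 0 HiE). apply near0_impl. tauto.
  (* Since q = 2 m, index m decodes to the pair (0, m), whose angles are 0 and 2 PI m / q = PI: this
     is the saddle. *)
  - exists m. split; [nia|].
    assert (Hdiv : (m / q = 0)%nat) by (apply Nat.div_small; lia).
    assert (Hmod : (m mod q = m)%nat) by (apply Nat.mod_small; lia).
    assert (Hx : cos (angle p 0 (m / q)) = 1).
    { rewrite Hdiv. unfold angle. simpl. rewrite Rmult_0_r, Rplus_0_r. unfold Rdiv.
      rewrite Rmult_0_l. apply cos_0. }
    assert (Hy : cos (angle q 0 (m mod q)) = -1).
    { rewrite Hmod, <- cos_PI. f_equal. unfold angle. rewrite Hm, mult_INR.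
      replace (INR 2) with 2 by reflexivity.
      assert (0 < INR m) by (apply lt_0_INR; lia). field. lra. }
    assert (H0 : eig p q 0 0 m = 0) by (unfold eig; rewrite Hx, Hy; lra).
    generalize (near0_and _ _ (eig_line_fst_max p q 0 0 0 m Hp H0 Hx)
      (eig_line_snd_min p q 0 0 0 m Hq H0 Hy)).
    apply near0_impl. intros t _ [HB HA]. left. split; [exact HB|]. left. apply HA.
Qed.

Theorem theorem3p1 :
  (forall r : nat, (0 < r)%nat -> Nat.Even r ->
     forall E : R, -4 < E < 4 -> E <> 0 ->
     exists j : nat, (1 <= j <= r * r)%nat /\ int_R (band r r j) E)
  /\
  (forall p q : nat, Nat.Odd p -> (0 < q)%nat -> Nat.divide 4 q ->
     exists j : nat, (1 <= j <= p * q)%nat /\ int_R (band p q j) 0).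
Proof.
  split.
  - intros r Hr _ E HE HE0. now apply band_interior_nonzero.
  - intros p q Hodd Hq [k Hk]. apply band_interior_zero; [exact Hodd|exact Hq|].
    exists (k * 2)%nat. lia.
Qed.
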